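(* Let $d\ge 0$ and $r\ge 2$ be integers, let $\langle\cdot,\cdot\rangle$ be any inner product on $\mathbb{R}[x]_{2d}$ with induced norm $\|\cdot\|$, and let $p\in\mathbb{R}[x]_{2d}$ be a univariate polynomial with $p(x)\ge 0$ for all $x\in\mathbb{R}$. Define $f_p:\mathbb{R}[x]_d^r\to\mathbb{R}$ by $f_p(u_1,\dots,u_r)=\big\|\sum_{i=1}^r u_i^2-p\big\|^2$. If $\mathbf{u}\in\mathbb{R}[x]_d^r$ satisfies $\nabla f_p(\mathbf{u})=0$ and $\nabla^2 f_p(\mathbf{u})\succeq 0$, then $f_p(\mathbf{u})=0$.
   Context: $\mathbb{R}[x]_d$ denotes the real vector space of univariate real polynomials of degree at most $d$; $\mathbb{R}[x]_d^r$ is the space of $r$-tuples of such polynomials, viewed as a finite-dimensional real vector space (e.g. via coefficients). Gradient and Hessian are taken with respect to this vector space structure: $\nabla f_p(\mathbf{u})=0$ means the directional derivative of $f_p$ at $\mathbf{u}$ vanishes in every direction $\mathbf{v}\in\mathbb{R}[x]_d^r$, and $\nabla^2 f_p(\mathbf{u})\succeq0$ means the second directional derivative $\frac{d^2}{d\epsilon^2}f_p(\mathbf{u}+\epsilon\mathbf{v})|_{\epsilon=0}$ is nonnegative for every $\mathbf{v}$. *)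

(* Defs.v *)
From HB Require Import structures.
From mathcomp Require Import all_boot all_order all_algebra.
From mathcomp Require Import all_classical all_reals all_analysis.
Set Implicit Arguments. Unset Strict Implicit. Unset Printing Implicit Defensive.
Import Order.TTheory GRing.Theory Num.Theory.
Local Open Scope ring_scope.

Definition deg_le (R : ringType) (n : nat) (q : {poly R}) : Prop :=
  (size q <= n.+1)%N.

Definition is_inner_product (R : realType) (n : nat)
  (ip : {poly R} -> {poly R} -> R) : Prop :=
  [/\ forall q s, deg_le n q -> deg_le n s -> ip q s = ip s q,
      forall (a : R) q q' s, deg_le n q -> deg_le n q' -> deg_le n s ->
        ip (a *: q + q') s = a * ip q s + ip q' s
    & forall q, deg_le n q -> q != 0 -> 0 < ip q q].

Definition ipnorm (R : realType) (ip : {poly R} -> {poly R} -> R) (q : {poly R}) : R :=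
  Num.sqrt (ip q q).

Definition f_p (R : realType) (ip : {poly R} -> {poly R} -> R) (p : {poly R})
  (r : nat) (u : 'I_r -> {poly R}) : R :=
  ipnorm ip (\sum_(i < r) u i ^+ 2 - p) ^+ 2.

(* Main.v *)
(* Put q = \sum u_i^2 - p and L = <q, .>.  Criticality says that L (\sum u_i v_i) = 0 and
   2 |\sum u_i v_i|^2 + L (\sum v_i^2) >= 0 for all v, and f_p(u) = -L(p).  As p is a sum
   of squares, it suffices to show L(s^2) >= 0 whenever deg s <= d.

   A Moebius change of variable makes some u_j of degree exactly d, so that the u_i have no
   common root at infinity.  Let g = gcd(u_i), of degree k, u_i = g a_i and
   h = \sum a_i^2.  Then L kills the multiples of g, and the syzygies
   w (a_l e_i - a_i e_l) give L(h w^2) >= 0 for deg w <= k.  When L(h w^2) = 0 these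
   syzygies lie in the radical of the Hessian, which forces L(w s) = 0 for all s.  Applied
   to the multiples w of g / gcd(g, h), this shows that L kills the multiples of
   g / gcd(g, h); iterating, L kills the multiples of a polynomial g' coprime to h.  If
   t h = 1 mod g', then s^2 = h \sum (a_i s t)^2 mod g', so L(s^2) >= 0. *)
Require Import Defs.
From HB Require Import structures.
From mathcomp Require Import all_boot all_order all_algebra.
From mathcomp Require Import all_classical all_reals all_analysis.
From mathcomp Require Import polyrcf.
From mathcomp Require Import ring lra zify.
Import Order.TTheory GRing.Theory Num.Theory.
Local Open Scope ring_scope.

(** * Degree bounds and Bezout identities *)

Lemma size_polyM_leq (R : nzRingType) (p q : {poly R}) (m n k : nat) :
  (size p <= m.+1)%N -> (size q <= n.+1)%N -> (m + n <= k)%N ->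
  (size (p * q)%R <= k.+1)%N.
Proof. by move=> hp hq hk; have := size_polyMleq p q; lia. Qed.

Lemma size_polyM_cancel (R : idomainType) (p q : {poly R}) (m n k : nat) :
  size p = m.+1 -> (size (p * q)%R <= k.+1)%N -> (k <= m + n)%N ->
  (size q <= n.+1)%N.
Proof.
move=> sp; have [->|q0] := eqVneq q 0; first by rewrite size_poly0.
by rewrite size_mul // -?size_poly_gt0 sp //; lia.
Qed.

Lemma size_polyM_lt (R : idomainType) (p q : {poly R}) :
  p != 0 -> (1 < size q)%N -> (size p < size (p * q)%R)%N.
Proof.
move=> p0 q1; have q0 : q != 0 by rewrite -size_poly_gt0 ltnW.
have := p0; rewrite size_mul // -size_poly_gt0; lia.
Qed.

Lemma size_polyD_leq (R : nzRingType) (p q : {poly R}) (n : nat) :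
  (size p <= n)%N -> (size q <= n)%N -> (size (p + q)%R <= n)%N.
Proof. by move=> hp hq; rewrite (leq_trans (size_polyD _ _)) // geq_max hp. Qed.

Lemma size_polyZ_leq (R : nzRingType) (a : R) (p : {poly R}) (n : nat) :
  (size p <= n)%N -> (size (a *: p)%R <= n)%N.
Proof. exact/leq_trans/size_scale_leq. Qed.

Lemma size_poly_sum_leq (R : nzRingType) (I : Type) (r : seq I) (P : pred I)
    (F : I -> {poly R}) (n : nat) :
  (forall i, P i -> (size (F i) <= n)%N) ->
  (size (\sum_(i <- r | P i) F i)%R <= n)%N.
Proof.
move=> h; apply: (big_ind (fun p : {poly R} => (size p <= n)%N)) => //.
  by rewrite size_poly0.
by move=> p q; apply: size_polyD_leq.
Qed.

Lemma sqr_modp_sub (F : fieldType) (g x : {poly F}) :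
  g %| x ^+ 2 - (x %% g) ^+ 2.
Proof.
by rewrite subr_sqr {1}(divp_eq x g) addrK dvdp_mulr // dvdp_mull.
Qed.

Lemma quad_form_first_order (F : realFieldType) (b c : F) :
  (forall e, 0 <= e * b + e ^+ 2 * c) -> b = 0.
Proof.
move=> h; apply/eqP/negPn/negP => b0.
(* At [e = - b / k] the form equals [b^2 / k^2] times [c - k], and [c < 1 + c^2]. *)
set k := 1 + c ^+ 2; have k0 : 0 < k by rewrite /k; nra.
have := h (- b / k).
have -> : - b / k * b + (- b / k) ^+ 2 * c = b ^+ 2 / k ^+ 2 * (c - k).
  by field; rewrite gt_eqF.
have b2 : 0 < b ^+ 2 / k ^+ 2 by apply: divr_gt0; [rewrite exprn_even_gt0 | apply: exprn_gt0].
rewrite pmulr_rge0 // /k; have := sqr_ge0 (c - 1); have := sqr_ge0 c.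
by rewrite !expr2; lra.
Qed.

(** A nonzero combination [g] of the [u i] of least size works: the remainder of [u i] modulo [g] is
    again a combination, of smaller size, hence zero. *)
Lemma exists_gcd_bezout (F : fieldType) (r : nat) (u : 'I_r -> {poly F}) (j : 'I_r) :
  u j != 0 ->
  exists2 g, forall i, g %| u i & exists b, g = \sum_i u i * b i /\ g != 0.
Proof.
move=> uj0.
have single i (c : {poly F}) : \sum_k u k * (if k == i then c else 0) = u i * c.
  by rewrite (bigD1 i) //= eqxx big1 ?addr0 // => k /negPf ->; rewrite mulr0.
pose P n := `[< exists b, size (\sum_i u i * b i)%R = n.+1 >].
have : exists n, P n.
  exists (size (u j)).-1; apply/asboolP.
  exists (fun k => if k == j then 1 else 0).
  by rewrite single mulr1 prednK // size_poly_gt0.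
move=> exP; case: (ex_minnP exP) => n /asboolP[b sb] nmin.
set g := \sum_i _ in sb.
have g0 : g != 0 by rewrite -size_poly_gt0 sb.
exists g; last by exists b.
move=> i; apply/modp_eq0P/eqP/negPn/negP => m0.
have lt := ltn_modpN0 (u i) g0.
have : P (size (u i %% g)).-1.
  apply/asboolP.
  exists (fun k => (if k == i then 1 else 0) - (u i %/ g) * b k).
  rewrite prednK ?size_poly_gt0 //; congr (size (polyseq _)).
  under eq_bigr => k _ do rewrite mulrBr mulrCA.
  rewrite sumrB single mulr1 -mulr_sumr -/g {1}(divp_eq (u i) g).
  by rewrite addrAC subrr add0r.
move=> /nmin; move: lt m0; rewrite sb -size_poly_gt0; lia.
Qed.

Section BoundedBezout.
Variables (F : fieldType) (r m d : nat) (a b : 'I_r -> {poly F}) (j : 'I_r).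
Hypotheses (ab : \sum_i a i * b i = 1) (sa : forall i, (size (a i) <= m.+1)%N).
Hypotheses (saj : size (a j) = m.+1) (md : (m <= d)%N).

(** The coefficients [s * b i] with [i != j] are reduced modulo [a j], and the quotients are pushed
    into the [j]-th one. That one is then bounded through its product with [a j], whose degree is
    exactly [m]. *)
Lemma bounded_bezout (s : {poly F}) : (size s <= (m + d).+1)%N ->
  exists2 v, forall i, (size (v i : {poly F}) <= d.+1)%N & \sum_i a i * v i = s.
Proof.
move=> ss; have aj0 : a j != 0 by rewrite -size_poly_gt0 saj.
pose v0 i := (s * b i) %% a j.
pose vj := s * b j + \sum_(i | i != j) a i * ((s * b i) %/ a j).
pose v i := if i == j then vj else v0 i.
have sv i : i != j -> (size (v i) <= m)%N.
  by move=> ij; rewrite /v (negPf ij) -ltnS -saj ltn_modp.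
have sumv : \sum_i a i * v i = s.
  rewrite (bigD1 j) //= {1}/v eqxx /vj mulrDr mulr_sumr -addrA -big_split /=.
  rewrite -[RHS]mulr1 -ab mulr_sumr [in RHS](bigD1 j) //=; congr (_ + _); first by ring.
  apply: eq_bigr => i ij; rewrite /v (negPf ij) /v0.
  rewrite [in RHS]mulrCA {3}(divp_eq (s * b i) (a j)); ring.
exists v => // i; case: (eqVneq i j) => [->|/sv]; last by lia.
have e : a j * v j = s - \sum_(i | i != j) a i * v i.
  by rewrite -sumv (bigD1 j) //= addrK.
apply: (@size_polyM_cancel _ (a j) _ m d (m + d)) => //.
rewrite e size_polyD_leq // size_polyN size_poly_sum_leq // => k kj.
by rewrite (@size_polyM_leq _ _ _ m d) // (leq_trans (sv _ kj)) // leqW.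
Qed.
End BoundedBezout.

(** * Second-order points with a coordinate of full degree *)

Section TopDegree.
(** [L] abstracts [<q, .>] and [Q] the Hessian term [2 |.|^2], of which homogeneity is kept. This
    form is stable under composition with a linear map, as the change of variable requires. *)
Variables (F : realFieldType) (r d : nat) (L : {scalar {poly F}}) (Q : {poly F} -> F).
Variables (u : 'I_r -> {poly F}) (j : 'I_r).
Hypotheses (r2 : (2 <= r)%N) (QZ : forall e y, Q (e *: y) = e ^+ 2 * Q y).
Hypotheses (su : forall i, (size (u i) <= d.+1)%N) (suj : size (u j) = d.+1).
Hypothesis Lgrad : forall v : 'I_r -> {poly F}, (forall i, (size (v i) <= d.+1)%N) ->
  L (\sum_i u i * v i) = 0.
Hypothesis Lhess : forall v : 'I_r -> {poly F}, (forall i, (size (v i) <= d.+1)%N) ->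
  0 <= Q (\sum_i u i * v i) + L (\sum_i v i ^+ 2).

Lemma kernel_psd (v : 'I_r -> {poly F}) : (forall i, (size (v i) <= d.+1)%N) ->
  \sum_i u i * v i = 0 -> 0 <= L (\sum_i v i ^+ 2).
Proof.
move=> sv uv; have := Lhess v sv; rewrite uv.
by have := QZ 0 0; rewrite scaler0 expr0n mul0r => ->; rewrite add0r.
Qed.

(** An isotropic vector of a positive semidefinite form lies in its radical: at [v + e v'] the
    Hessian is [e] times [2 L (\sum_i v i * v' i)] plus a multiple of [e ^+ 2], so nonnegativity for
    all [e] kills the linear term. *)
Lemma kernel_null (v v' : 'I_r -> {poly F}) : (forall i, (size (v i) <= d.+1)%N) ->
  (forall i, (size (v' i) <= d.+1)%N) ->
  \sum_i u i * v i = 0 -> L (\sum_i v i ^+ 2) = 0 -> L (\sum_i v i * v' i) = 0.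
Proof.
move=> sv sv' uv Lv.
suff : 2 * L (\sum_i v i * v' i) = 0 by move=> /eqP; rewrite mulf_eq0 pnatr_eq0 => /eqP.
apply: (@quad_form_first_order _ _ (Q (\sum_i u i * v' i) + L (\sum_i v' i ^+ 2))) => e.
have := Lhess (fun i => v i + e *: v' i).
have -> : \sum_i u i * (v i + e *: v' i) = e *: \sum_i u i * v' i.
  under eq_bigr => i _ do rewrite mulrDr -scalerAr.
  by rewrite big_split /= uv add0r scaler_sumr.
have -> : \sum_i (v i + e *: v' i) ^+ 2 = \sum_i v i ^+ 2 +
    (e + e) *: (\sum_i v i * v' i) + e ^+ 2 *: (\sum_i v' i ^+ 2).
  rewrite !scaler_sumr -!big_split /=; apply: eq_bigr => i _.
  by rewrite -!mul_polyC polyCD polyC_exp; ring.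
rewrite QZ !linearD !linearZ /= Lv add0r => h.
have {}h := h (fun i => size_polyD_leq _ _ _ _ (sv i) (size_polyZ_leq _ _ _ _ (sv' i))).
by move: h; congr (_ <= _); ring.
Qed.

(** * Coordinates divided by their greatest common divisor *)

Section Factored.
Variables (g : {poly F}) (a b : 'I_r -> {poly F}) (k m : nat).
Hypotheses (ua : forall i, u i = g * a i) (ab : \sum_i a i * b i = 1).
Hypotheses (kmd : (k + m = d)%N) (sg : size g = k.+1) (saj : size (a j) = m.+1).
Hypothesis sa : forall i, (size (a i) <= m.+1)%N.

Let h := \sum_i a i ^+ 2.

(** As [y] has degree at most [m + d], [bounded_bezout] writes it as [\sum_i a i * v i] with each
    [v i] of degree at most [d]; then [g * y] is [\sum_i u i * v i], which the gradient condition
    kills. *)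
Lemma vanish_gcd (y : {poly F}) : (size (g * y)%R <= (2 * d).+1)%N -> L (g * y) = 0.
Proof.
move=> sy; have sy' : (size y <= (m + d).+1)%N.
  by apply: (@size_polyM_cancel _ g y k _ _ sg sy); lia.
have md : (m <= d)%N by lia.
have [v sv <-] := bounded_bezout _ _ _ _ _ _ _ ab sa saj md _ sy'.
rewrite mulr_sumr -[RHS](Lgrad v sv); congr (L _).
by apply: eq_bigr => i _; rewrite ua mulrA.
Qed.

Let syz (w : {poly F}) (i l : 'I_r) : 'I_r -> {poly F} :=
  fun n => if n == i then w * a l else if n == l then - (w * a i) else 0.

Let sum_syz (w : {poly F}) (i l : 'I_r) (c : 'I_r -> {poly F}) : i != l ->
  \sum_n syz w i l n * c n = w * (a l * c i - a i * c l).
Proof.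
move=> il; rewrite (bigD1 i) //= (bigD1 l) /= 1?eq_sym //.
rewrite big1 => [|n /andP[ni nl]].
  by rewrite /syz eqxx eq_sym (negPf il) eqxx; ring.
by rewrite /syz (negPf ni) (negPf nl) mul0r.
Qed.

Let sum_syz2 (w : {poly F}) (i l : 'I_r) : i != l ->
  \sum_n syz w i l n ^+ 2 = (a i ^+ 2 + a l ^+ 2) * w ^+ 2.
Proof.
move=> il; under eq_bigr => n _ do rewrite expr2.
by rewrite sum_syz // /syz eqxx eq_sym (negPf il) eqxx; ring.
Qed.

Let size_syz (w : {poly F}) (i l n : 'I_r) : (size w <= k.+1)%N -> (size (syz w i l n) <= d.+1)%N.
Proof.
move=> sw; rewrite /syz; case: eqP => _; last case: eqP => _; last by rewrite size_poly0.
  by rewrite (@size_polyM_leq _ _ _ k m) // kmd.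
by rewrite size_polyN (@size_polyM_leq _ _ _ k m) // kmd.
Qed.

Let syz_ker (w : {poly F}) (i l : 'I_r) : i != l -> \sum_n u n * syz w i l n = 0.
Proof.
move=> il; under eq_bigr => n _ do rewrite mulrC.
by rewrite sum_syz // !ua; ring.
Qed.

Lemma pair_psd (w : {poly F}) (i l : 'I_r) : (size w <= k.+1)%N ->
  i != l -> 0 <= L ((a i ^+ 2 + a l ^+ 2) * w ^+ 2).
Proof.
move=> sw il; rewrite -sum_syz2 //; apply: kernel_psd; last exact: syz_ker.
by move=> n; apply: size_syz.
Qed.

(** Double counting: each index occurs [r - 1] times in first and [r - 1] times in second position.
    For [r >= 2] the factor is positive, so signs and zeros pass between the pairs and [h]. *)
Let sum_pairs (w : {poly F}) : \sum_i \sum_(l | l != i) L ((a i ^+ 2 + a l ^+ 2) * w ^+ 2) =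
  (2 * r.-1)%:R * L (h * w ^+ 2).
Proof.
pose x i := L (a i ^+ 2 * w ^+ 2).
have xE : L (h * w ^+ 2) = \sum_i x i by rewrite /h mulr_suml linear_sum.
have card1 (i : 'I_r) : \sum_(l | l != i) x i = r.-1%:R * x i.
  by rewrite sumr_const cardC1 card_ord mulr_natl.
transitivity (\sum_i (\sum_(l | l != i) x i + \sum_(l | l != i) x l)).
  by apply: eq_bigr => i _; rewrite -big_split; apply: eq_bigr => l _; rewrite mulrDl linearD.
rewrite big_split /= xE [X in _ + X](_ : _ = \sum_i \sum_(l | l != i) x i).
  under eq_bigr => i _ do rewrite card1.
  by rewrite -mulr_sumr natrM; ring.
under eq_bigr => i _ do rewrite big_mkcond.
rewrite exchange_big; apply: eq_bigr => i _ /=; rewrite -big_mkcond /=.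
by apply: eq_bigl => l; rewrite eq_sym.
Qed.

Lemma sum_sqr_psd (w : {poly F}) : (size w <= k.+1)%N -> 0 <= L (h * w ^+ 2).
Proof.
move=> sw; rewrite -(@pmulr_rge0 _ (2 * r.-1)%:R) ?ltr0n; last by lia.
rewrite -sum_pairs; apply: sumr_ge0 => i _; apply: sumr_ge0 => l li.
by apply: pair_psd; rewrite // eq_sym.
Qed.

(* If [L (h * w ^+ 2) = 0], every syzygy [w (a_l e_i - a_i e_l)] is isotropic for the
   Hessian, hence in its radical; pairing it with [v_l e_i] gives [L (w a_l v_l) = 0]. *)
Lemma sum_sqr_null (w s : {poly F}) : (size w <= k.+1)%N -> L (h * w ^+ 2) = 0 ->
  (size s <= (m + d).+1)%N -> L (w * s) = 0.
Proof.
move=> sw Lw ss.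
(* The pair terms are nonnegative and add up to zero. *)
have pair0 i l : i != l -> L ((a i ^+ 2 + a l ^+ 2) * w ^+ 2) = 0.
  move=> il; apply/eqP; have := sum_pairs w; rewrite Lw mulr0 => /eqP.
  rewrite psumr_eq0 => [|n _]; last first.
    by apply: sumr_ge0 => n' nn; apply: pair_psd; rewrite // eq_sym.
  move=> /allP /(_ i (mem_index_enum _)) /=.
  rewrite psumr_eq0 => [|n nn]; last by apply: pair_psd; rewrite // eq_sym.
  by move=> /allP /(_ l (mem_index_enum _)) /implyP; apply; rewrite eq_sym.
have md : (m <= d)%N by lia.
have [v sv <-] := bounded_bezout _ _ _ _ _ _ _ ab sa saj md _ ss.
rewrite mulr_sumr linear_sum big1 // => l _.
have [i il] : exists i, i != l.
  apply/existsP; rewrite -negb_forall; apply/negP => /forallP al.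
  have : (#|'I_r| <= #|pred1 l|)%N by apply/subset_leq_card/fintype.subsetP => x _; apply: al.
  by rewrite card_ord card1; lia.
pose v' n := if n == i then v l else 0.
have sv' n : (size (v' n) <= d.+1)%N.
  by rewrite /v'; case: eqP => _ //; rewrite size_poly0.
have := kernel_null (syz w i l) v' (fun n => size_syz w i l n sw) sv' (syz_ker w i l il).
rewrite sum_syz2 // sum_syz // => /(_ (pair0 _ _ il)).
by rewrite /v' eqxx eq_sym (negPf il) mulr0 subr0.
Qed.

(** The iteration is replaced by a choice of [g'] of least size: a nontrivial [c = gcd(h, g')] would
    make the smaller [g' / c] eligible as well. *)
Lemma vanish_coprime : exists2 g' : {poly F}, coprimep h g' &
  [/\ g' != 0, (size g' <= k.+1)%N &
    forall y : {poly F}, (size (g' * y)%R <= (2 * d).+1)%N -> L (g' * y) = 0].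
Proof.
pose good n := `[< exists2 g' : {poly F}, size g' = n &
  [/\ g' != 0, (size g' <= k.+1)%N &
    forall y : {poly F},
      (size (g' * y)%R <= (2 * d).+1)%N -> L (g' * y) = 0] >].
have : exists n, good n.
  exists k.+1; apply/asboolP; exists g => //.
  by rewrite sg; split=> //; [rewrite -size_poly_gt0 sg | exact: vanish_gcd].
move=> exg; case: (ex_minnP exg) => n /asboolP[g' sg' [g'0 g'k Lg']] nmin.
exists g' => //; apply/negPn/negP => ncop.
pose c : {poly F} := gcdp h g'; pose q : {poly F} := g' %/ c.
have g'E : g' = q * c by rewrite /q divpK // dvdp_gcdr.
have q0 : q != 0 by apply: contraNneq g'0 => q0; rewrite g'E q0 mul0r.
have c1 : (1 < size c)%N.
  move: ncop; rewrite /coprimep -/c ltn_neqAle eq_sym => ->.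
  by rewrite size_poly_gt0 gcdp_eq0 negb_and g'0 orbT.
have qlt : (size q < size g')%N by rewrite g'E size_polyM_lt.
have sh : (size h <= (2 * m).+1)%N.
  apply: size_poly_sum_leq => i _; rewrite expr2 (@size_polyM_leq _ _ _ m m) //; lia.
(* Since [c] divides [h] and [g' = q * c], already [h * q] is a multiple of [g']. *)
have Lhq t : (size (q * t)%R <= k.+1)%N -> L (h * (q * t) ^+ 2) = 0.
  move=> st.
  have hE : h = h %/ c * c by rewrite divpK // dvdp_gcdl.
  have e : h * (q * t) ^+ 2 = g' * (h %/ c * q * t ^+ 2).
    by rewrite {1}hE g'E; ring.
  rewrite e; apply: Lg'; rewrite -e.
  rewrite (@size_polyM_leq _ _ _ (2 * m) (2 * k)) //; last by lia.
  by rewrite expr2 (@size_polyM_leq _ _ _ k k) //; lia.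
have sq1 : (0 < size q)%N by rewrite size_poly_gt0.
suff : good (size q) by move=> /nmin; lia.
apply/asboolP; exists q => //; split => // [|y sy]; first by lia.
(* [e] is [k] minus the degree of [q]. Cutting [y] at degree [e] leaves both [q * take_poly e y] and
   [q * 'X^e] of degree at most [k], and the cofactors [1] and [drop_poly e y] of degree at most
   [m + d], as [sum_sqr_null] demands. *)
pose e := (k.+1 - size q)%N.
have sy' : (size y <= (2 * d - (size q).-1).+1)%N.
  by apply: (@size_polyM_cancel _ q y (size q).-1 _ (2 * d)); rewrite ?prednK //; lia.
have st : (size (q * take_poly e y)%R <= k.+1)%N.
  have e0 : (0 < e)%N by lia.
  by apply: (@size_polyM_leq _ _ _ (size q).-1 e.-1); rewrite ?prednK ?size_take_poly //; lia.
have sX : (size (q * 'X^e)%R <= k.+1)%N.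
  by apply: (@size_polyM_leq _ _ _ (size q).-1 e); rewrite ?prednK ?size_polyXn //; lia.
have -> : q * y = q * take_poly e y * 1 + q * 'X^e * drop_poly e y.
  by rewrite -{1}(poly_take_drop e y); ring.
have L1 : L (q * take_poly e y * 1) = 0.
  by apply: sum_sqr_null; rewrite ?size_poly1 ?Lhq.
have L2 : L (q * 'X^e * drop_poly e y) = 0.
  by apply: sum_sqr_null; rewrite ?Lhq ?size_drop_poly //; lia.
by rewrite linearD /= L1 L2 addr0.
Qed.

Lemma sqr_psd_factored (s : {poly F}) : (size s <= d.+1)%N -> 0 <= L (s ^+ 2).
Proof.
move=> ss; have [g' cop [g'0 g'k Lg']] := vanish_coprime.
have [[t z] /= /eqpP[[c1 c2] /= /andP[c10 c20] E]] := Bezout_coprimepP _ _ cop.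
(* The Bezout identity holds up to nonzero constants, which this rescaling absorbs. *)
pose t' := (c1 / c2) *: t; pose z' := (c1 / c2) *: z.
have {}E : t' * h + z' * g' = 1.
  rewrite -!scalerAl -scalerDr mulrC -scalerA E scalerA mulVf ?scale1r //.
(* Here [h \sum_i x_i^2 = (h t' s)^2], congruent to [s^2] modulo [g']. Passing to the remainders
   [w i] keeps the congruence and brings the degree down to [k], within reach of [sum_sqr_psd]. *)
pose x i := a i * s * t'; pose w i := x i %% g'.
have sw i : (size (w i) <= k.+1)%N.
  by apply: leq_trans g'k; apply/ltnW/ltn_modpN0.
have dv : g' %| s ^+ 2 - h * \sum_i w i ^+ 2.
  have -> : s ^+ 2 - h * \sum_i w i ^+ 2 =
      h * (\sum_i (x i ^+ 2 - w i ^+ 2)) + s ^+ 2 * (1 + t' * h) * (z' * g').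
    have -> : z' * g' = 1 - t' * h by rewrite -E; ring.
    rewrite sumrB; have -> : \sum_i x i ^+ 2 = h * (s * t') ^+ 2; last by ring.
    by rewrite mulr_suml; apply: eq_bigr => i _; rewrite /x; ring.
  rewrite dvdp_add //; last by rewrite mulrA dvdp_mull.
  apply/dvdp_mull/(big_ind (fun f => g' %| f)) => [|f f'|i _]; first exact: dvdp0.
    exact: dvdp_add.
  exact: sqr_modp_sub.
have sw2 i : (size (h * w i ^+ 2)%R <= (2 * d).+1)%N.
  rewrite (@size_polyM_leq _ _ _ (2 * m) (2 * k)) //; last by lia.
    by apply: size_poly_sum_leq => l _; rewrite expr2 (@size_polyM_leq _ _ _ m m) //; lia.
  by rewrite expr2 (@size_polyM_leq _ _ _ k k) //; lia.
have : L (s ^+ 2 - h * \sum_i w i ^+ 2) = 0.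
  rewrite -(divpK dv) mulrC; apply: Lg'; rewrite mulrC divpK //.
  rewrite size_polyD_leq //; first by rewrite expr2 (@size_polyM_leq _ _ _ d d) //; lia.
  by rewrite size_polyN mulr_sumr size_poly_sum_leq.
rewrite linearB /= mulr_sumr linear_sum /= => /eqP; rewrite subr_eq0 => /eqP ->.
by apply: sumr_ge0 => i _; apply: sum_sqr_psd.
Qed.

End Factored.

(** Cancelling the gcd in its own Bezout identity gives [ab]; the full degree of [u j] yields
    [k + m = d], which in turn bounds every [a i] by degree [m]. *)
Lemma sqr_psd_top (s : {poly F}) : (size s <= d.+1)%N -> 0 <= L (s ^+ 2).
Proof.
have uj0 : u j != 0 by rewrite -size_poly_gt0 suj.
have [g gu [b [gE g0]]] := exists_gcd_bezout _ _ u j uj0.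
pose a i := u i %/ g.
have ua i : u i = g * a i by rewrite mulrC divpK.
have ab : \sum_i a i * b i = 1.
  apply: (mulfI g0); rewrite mulr1 {2}gE mulr_sumr.
  by apply: eq_bigr => i _; rewrite mulrA -ua.
have aj0 : a j != 0 by apply: contraNneq uj0 => e; rewrite ua e mulr0.
pose k := (size g).-1; pose m := (size (a j)).-1.
have sg : size g = k.+1 by rewrite prednK // size_poly_gt0.
have sa : size (a j) = m.+1 by rewrite prednK // size_poly_gt0.
have kmd : (k + m)%N = d.
  by have := suj; rewrite ua size_mul // sg sa; lia.
apply: (sqr_psd_factored g a b k m) => // i.
by apply: (size_polyM_cancel _ g (a i) k m d sg); rewrite -?ua // kmd.
Qed.

End TopDegree.

(** * Moving the point at infinity *)

(** For [p] of degree at most [n] this is [x^n p(1/x)]; fixing [n] independently of [p] makes the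
    map linear. *)
Definition rev_poly (R : nzRingType) (n : nat) (p : {poly R}) : {poly R} :=
  \poly_(i < n.+1) p`_(n - i).

Lemma rev_poly_is_linear (R : nzRingType) (n : nat) : linear (@rev_poly R n).
Proof.
move=> a p q; apply/polyP => i; rewrite coefD coefZ !coef_poly.
by case: ifP => _; rewrite ?coefD ?coefZ // mulr0 addr0.
Qed.

HB.instance Definition _ (R : nzRingType) (n : nat) :=
  GRing.isLinear.Build R {poly R} {poly R} _ (@rev_poly R n) (@rev_poly_is_linear R n).

Lemma size_rev_poly (R : nzRingType) (n : nat) (p : {poly R}) :
  (size (rev_poly R n p) <= n.+1)%N.
Proof. exact: size_poly. Qed.

Lemma rev_polyK (R : nzRingType) (n : nat) (p : {poly R}) :
  (size p <= n.+1)%N -> rev_poly R n (rev_poly R n p) = p.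
Proof.
move=> sp; apply/polyP => i; rewrite coef_poly.
case: ltnP => [lin|]; last by move=> ni; rewrite nth_default // (leq_trans sp).
by rewrite coef_poly ltnS leq_subr subKn.
Qed.

Lemma rev_polyXnM (R : nzRingType) (m n i : nat) (p : {poly R}) :
  (i <= m)%N -> (size p <= n.+1)%N ->
  rev_poly R (m + n) ('X^i * p) = 'X^(m - i) * rev_poly R n p.
Proof.
move=> im sp; apply/polyP => l; rewrite coefXnM !coef_poly coefXnM.
case: (ltnP l (m - i)) => lmi.
  rewrite [RHS]/= ifT; last by lia.
  by case: ifP => // _; rewrite nth_default // (leq_trans sp) //; lia.
case: (ltnP l (m + n).+1) => lmn; last by rewrite ifF //; lia.
case: (ltnP (l - (m - i)) n.+1) => h; last by rewrite ifT //; lia.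
by rewrite ifF; [congr (_`_ _); lia | lia].
Qed.

Lemma rev_polyM (R : comNzRingType) (m n : nat) (p q : {poly R}) :
  (size p <= m.+1)%N -> (size q <= n.+1)%N ->
  rev_poly R (m + n) (p * q) = rev_poly R m p * rev_poly R n q.
Proof.
move=> sp sq; have -> : p = \sum_(i < m.+1) p`_i *: 'X^i.
  by rewrite -poly_def; apply/esym/take_poly_id.
rewrite mulr_suml !linear_sum mulr_suml; apply: eq_bigr => i _ /=.
rewrite -scalerAl !linearZ -scalerAl /= rev_polyXnM //; last by rewrite -ltnS.
congr (_ *: (_ * _)); have := @rev_polyXnM R m 0 i 1.
rewrite addn0 mulr1 size_poly1 -ltnS => -> //.
have -> : rev_poly R 0 1 = 1; last by rewrite mulr1.
by apply/polyP => l; rewrite coef_poly !coef1; case: l.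
Qed.

Lemma exists_not_root (F : realFieldType) (p : {poly F}) : p != 0 -> exists c, p.[c] != 0.
Proof.
move=> p0; apply: contrapT => h; move: p0; apply/negP/negPn/eqP.
apply: (@roots_geq_poly_eq0 _ _ [seq i%:R | i <- iota 0 (size p)]).
- by apply/allP => x _; apply/negPn/negP => px; apply: h; exists x.
- by rewrite map_inj_uniq ?iota_uniq //; apply: mulrIn; rewrite oner_eq0.
- by rewrite size_map size_iota.
Qed.

Section Dehomogenization.
Variables (F : realFieldType) (c : F).

(* [mobius n p] and [mobius_inv n p] are [x^n p(c + 1/x)] and [(x - c)^n p(1/(x - c))]. *)
Definition mobius (n : nat) (p : {poly F}) : {poly F} := rev_poly F n (p \Po ('X + c%:P)).
Definition mobius_inv (n : nat) (p : {poly F}) : {poly F} := rev_poly F n p \Po ('X - c%:P).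

Lemma mobius_inv_is_linear n : linear (mobius_inv n).
Proof. by move=> a p q; rewrite /mobius_inv linearP comp_polyD comp_polyZ. Qed.

HB.instance Definition _ (n : nat) :=
  GRing.isLinear.Build F {poly F} {poly F} _ (mobius_inv n) (mobius_inv_is_linear n).

Lemma size_mobius n (p : {poly F}) : (size (mobius n p) <= n.+1)%N.
Proof. exact: size_rev_poly. Qed.

Lemma size_mobius_inv n (p : {poly F}) : (size (mobius_inv n p) <= n.+1)%N.
Proof. by rewrite size_comp_poly2 ?size_XsubC // size_rev_poly. Qed.

Lemma mobiusK n (p : {poly F}) : (size p <= n.+1)%N -> mobius_inv n (mobius n p) = p.
Proof.
move=> sp; rewrite /mobius_inv rev_polyK; last by rewrite size_comp_poly2 ?size_XaddC.
by rewrite -comp_polyA comp_polyD comp_polyX comp_polyC subrK comp_polyXr.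
Qed.

Lemma mobius_invM n (p q : {poly F}) : (size p <= n.+1)%N -> (size q <= n.+1)%N ->
  mobius_inv (2 * n) (p * q) = mobius_inv n p * mobius_inv n q.
Proof. by move=> sp sq; rewrite /mobius_inv mul2n -addnn rev_polyM // comp_polyM. Qed.

(** The coefficient of degree [n] is the value [p.[c]]. *)
Lemma size_mobius_eq n (p : {poly F}) : p.[c] != 0 -> size (mobius n p) = n.+1.
Proof.
move=> pc; apply/eqP; rewrite eqn_leq size_mobius ltnNge; apply/negP => /leq_sizeP/(_ n (leqnn n)).
rewrite coef_poly ltnSn subnn -horner_coef0 horner_comp !hornerE => /eqP.
by rewrite (negPf pc).
Qed.
End Dehomogenization.

Lemma second_order_sqr_psd (F : realFieldType) (r d : nat) (L : {scalar {poly F}})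
    (Q : {poly F} -> F) (u : 'I_r -> {poly F}) :
  (2 <= r)%N -> (forall e y, Q (e *: y) = e ^+ 2 * Q y) ->
  (forall i, (size (u i) <= d.+1)%N) ->
  (forall v : 'I_r -> {poly F}, (forall i, (size (v i) <= d.+1)%N) ->
     L (\sum_i u i * v i) = 0) ->
  (forall v : 'I_r -> {poly F}, (forall i, (size (v i) <= d.+1)%N) ->
     0 <= Q (\sum_i u i * v i) + L (\sum_i v i ^+ 2)) ->
  forall s : {poly F}, (size s <= d.+1)%N -> 0 <= L (s ^+ 2).
Proof.
move=> r2 QZ su Lgrad Lhess s ss.
have [/existsP[j uj]|/negP u0] := boolP [exists j, u j != 0]; last first.
  (* At [u = 0] the direction with single entry [s] turns the Hessian condition into
     [0 <= L (s ^+ 2)]. *)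
  have i0 : 'I_r by case: r r2 {u su Lgrad Lhess u0} => // r' _; exact: ord0.
  pose v i := if i == i0 then s else 0 : {poly F}.
  have sv i : (size (v i) <= d.+1)%N by rewrite /v; case: ifP; rewrite ?size_poly0.
  have := Lhess v sv; rewrite [\sum_i u i * v i]big1 => [|i _]; last first.
    have [->|ui] := eqVneq (u i) 0; first by rewrite mul0r.
    by case: u0; apply/existsP; exists i.
  have := QZ 0 0; rewrite scaler0 expr0n mul0r => ->; rewrite add0r.
  rewrite (bigD1 i0) //= {1}/v eqxx big1 ?addr0 // => i /negPf ii0.
  by rewrite /v ii0 expr0n.
(* Sending [c] to infinity gives the transformed [u j] full degree. [L] and [Q] are pulled back
   along [mobius_inv] at degree [2 d], and its multiplicativity carries over both second-order
   conditions. *)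
have [c ujc] := exists_not_root F (u j) uj.
pose S n : {linear {poly F} -> {poly F}} := mobius_inv F c n.
pose L' : {scalar {poly F}} := L \o S (2 * d)%N.
have SM (a b : {poly F}) : (size a <= d.+1)%N -> (size b <= d.+1)%N ->
  S (2 * d)%N (a * b) = S d a * S d b by apply: mobius_invM.
have Ssum (v : 'I_r -> {poly F}) : (forall i, (size (v i) <= d.+1)%N) ->
    S (2 * d)%N (\sum_i mobius F c d (u i) * v i) = \sum_i u i * S d (v i).
  move=> sv; rewrite linear_sum; apply: eq_bigr => i _.
  by rewrite SM ?size_mobius // /S /= mobiusK.
have := @sqr_psd_top F r d L' (Q \o S (2 * d)%N) (fun i => mobius F c d (u i)) j r2.
have {1}-> : s = S d (mobius F c d s) by rewrite /S /= mobiusK.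
rewrite expr2 -SM ?size_mobius // => top.
apply: top.
- by move=> e y; rewrite /= linearZ QZ.
- by move=> i; rewrite size_mobius.
- exact: size_mobius_eq.
- by move=> v sv; rewrite /= Ssum // Lgrad // => i; apply: size_mobius_inv.
- move=> v sv; rewrite /= Ssum //.
  have -> : S (2 * d)%N (\sum_i v i ^+ 2) = \sum_i S d (v i) ^+ 2.
    by rewrite linear_sum; apply: eq_bigr => i _; rewrite expr2 SM.
  by apply: Lhess => i; apply: size_mobius_inv.
- exact: size_mobius.
Qed.

(** * Nonnegative polynomials are sums of squares *)

Section Minimum.
Import numFieldNormedType.Exports.

(** A nonconstant nonnegative polynomial has positive leading coefficient. Applied to [p(x)] and
    [p(-x)], this puts all values outside some [[-B, B]] above [p.[0]], and compactness of the
    interval does the rest. *)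
Lemma poly_min_attained (R : realType) (p : {poly R}) :
  (forall x, 0 <= p.[x]) -> exists a, forall x, p.[a] <= p.[x].
Proof.
move=> p0; have [sp|sp] := leqP (size p) 1.
  by exists 0 => x; rewrite (size1_polyC sp) !hornerC.
have lim (q : {poly R}) : (1 < size q)%N -> (forall x, 0 <= q.[x]) ->
    exists n, forall x, n <= x -> p.[0] <= q.[x].
  move=> sq q0; apply: poly_lim_infty => //; rewrite ltNge; apply/negP => lq.
  have lq' : 0 < lead_coef (- q).
    by rewrite lead_coefN oppr_gt0 lt_neqAle lq lead_coef_eq0 -size_poly_gt0 ltnW.
  have [|n] := poly_lim_infty 1 lq'; first by rewrite size_polyN.
  move=> /(_ n (lexx n)); have := q0 n; rewrite hornerN; lra.
have sc : size (p \Po - 'X) = size p by rewrite size_comp_poly2 // size_polyN size_polyX.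
have [n1 h1] := lim p sp p0.
have [|x|n2 h2] := lim (p \Po - 'X); [by rewrite sc| |].
  by rewrite horner_comp.
pose B := `|n1| + `|n2|.
have B0 : 0 <= B by rewrite addr_ge0.
have [c _ cmin] : exists2 c, c \in `[- B, B] & forall t, t \in `[- B, B] -> p.[c] <= p.[t].
  apply: (@EVT_min R (horner p)); first by lra.
  by apply: continuous_subspaceT; apply: continuous_horner.
have c0 : p.[c] <= p.[0] by apply: cmin; rewrite in_itv /=; apply/andP; split; lra.
have hn1 := ler_norm n1; have hn2 := ler_norm n2.
have n1p := normr_ge0 n1; have n2p := normr_ge0 n2.
exists c => x; have [xB|xB] := leP x (- B).
  have := h2 (- x); rewrite horner_comp !hornerE opprK /B in xB * => h.
  by apply: (le_trans c0); apply: h; lra.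
have [Bx|Bx] := leP B x; first by apply: (le_trans c0); apply: h1; rewrite /B in Bx; lra.
by apply: cmin; rewrite in_itv /= !ltW.
Qed.

End Minimum.

(** Away from [a] the square is positive and can be cancelled; at [a] continuity excludes a negative
    value. *)
Lemma poly_nonneg_cofactor (R : realType) (s : {poly R}) (a : R) :
  (forall x, 0 <= s.[x] * (x - a) ^+ 2) -> forall x, 0 <= s.[x].
Proof.
move=> h; have off x : x != a -> 0 <= s.[x].
  move=> xa; rewrite -(@pmulr_lge0 _ ((x - a) ^+ 2)) // exprn_even_gt0 //=.
  by rewrite subr_eq0.
move=> x; have [->|/off //] := eqVneq x a; rewrite leNgt; apply/negP => sa.
have [e e0 he] := poly_cont a s (ltac:(lra) : 0 < - s.[a]).
have := he (a + e / 2); rewrite addrAC subrr add0r gtr0_norm; last by lra.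
move=> /(_ ltac:(lra)) /ltr_normlP[_]; have := off (a + e / 2).
rewrite -subr_eq0 addrAC subrr add0r => /(_ ltac:(lra)); lra.
Qed.

(* At a global minimum [a], [p - p(a)] vanishes to even order, so it is
   [(x - a)^2] times a nonnegative polynomial of smaller degree. *)
Lemma poly_nonneg_sos (R : realType) (d : nat) (p : {poly R}) :
  (size p <= (2 * d).+1)%N -> (forall x, 0 <= p.[x]) ->
  exists2 t : seq {poly R}, all (fun q => (size (polyseq q) <= d.+1)%N) t &
    p = \sum_(q <- t) q ^+ 2.
Proof.
elim: d p => [|d IH] p sp p0.
  exists [:: (Num.sqrt p`_0)%:P]; first by rewrite /= size_polyC leq_b1.
  rewrite big_seq1 -polyC_exp sqr_sqrtr -?size1_polyC //.
  by rewrite -horner_coef0.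
have [a amin] := poly_min_attained _ p p0.
pose p1 := p - (p.[a])%:P.
have p1ge x : 0 <= p1.[x] by rewrite /p1 !hornerE subr_ge0.
have [s1 s1E] : exists s1, p1 = s1 * ('X - a%:P).
  by apply/factor_theorem; rewrite /root /p1 !hornerE subrr.
(* Otherwise [s1] keeps its sign near [a] while [x - a] changes sign, so [p1] is negative at
   [a - e / 2] or at [a + e / 2]. *)
have s1a : s1.[a] = 0.
  apply/eqP; rewrite eq_le; apply/andP; split; rewrite leNgt; apply/negP => sa.
    have [e e0 he] := poly_cont a s1 sa.
    have := he (a - e / 2); rewrite addrAC subrr add0r normrN gtr0_norm; last by lra.
    move=> /(_ ltac:(lra)) /ltr_normlP[h _].
    have := p1ge (a - e / 2); rewrite s1E !hornerE.
    by rewrite addrAC subrr add0r nmulr_lge0; lra.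
  have [e e0 he] := poly_cont a s1 (ltac:(lra) : 0 < - s1.[a]).
  have := he (a + e / 2); rewrite addrAC subrr add0r gtr0_norm; last by lra.
  move=> /(_ ltac:(lra)) /ltr_normlP[_ h].
  have := p1ge (a + e / 2); rewrite s1E !hornerE.
  by rewrite addrAC subrr add0r pmulr_lge0; lra.
have [s sE] : exists s, s1 = s * ('X - a%:P) by apply/factor_theorem/eqP.
have p1E : p1 = s * ('X - a%:P) ^+ 2 by rewrite s1E sE expr2 mulrA.
have ss : (size s <= (2 * d).+1)%N.
  apply: (@size_polyM_cancel _ (('X - a%:P) ^+ 2) s 2 _ (2 * d.+1)); last by lia.
    by rewrite size_exp_XsubC.
  rewrite mulrC -p1E size_polyD_leq // size_polyN.
  by rewrite (leq_trans (size_polyC_leq1 _)).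
have s0 : forall x, 0 <= s.[x].
  by apply: (poly_nonneg_cofactor _ _ a) => x; have := p1ge x; rewrite p1E !hornerE.
have [t st tE] := IH s ss s0.
exists ((Num.sqrt p.[a])%:P :: [seq ('X - a%:P) * q | q <- t]).
  rewrite /= (leq_trans (size_polyC_leq1 _)) //= all_map.
  apply/allP => q /(allP st) /= sq.
  by rewrite (@size_polyM_leq _ _ _ 1 d) // ?size_XsubC //.
rewrite big_cons big_map -polyC_exp sqr_sqrtr //.
under eq_bigr => q _ do rewrite exprMn mulrC.
by rewrite -mulr_suml -tE -p1E /p1 addrC subrK.
Qed.

(** * Derivatives of the objective *)

Section InnerProduct.
Variables (R : realType) (n : nat) (ip : {poly R} -> {poly R} -> R).
Hypothesis hip : is_inner_product n ip.

Lemma ipC q s : deg_le n q -> deg_le n s -> ip q s = ip s q.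
Proof. by case: hip => h _ _; apply: h. Qed.

Lemma ipP a q q' s : deg_le n q -> deg_le n q' -> deg_le n s ->
  ip (a *: q + q') s = a * ip q s + ip q' s.
Proof. by case: hip => _ h _; apply: h. Qed.

Lemma ip0l s : deg_le n s -> ip 0 s = 0.
Proof.
have d0 : deg_le n (0 : {poly R}) by rewrite /deg_le size_poly0.
by move=> ds; have := ipP (-1) 0 0 s d0 d0 ds; rewrite scaler0 addr0 mulN1r addNr.
Qed.

Lemma ipZl a q s : deg_le n q -> deg_le n s -> ip (a *: q) s = a * ip q s.
Proof.
move=> dq ds; rewrite -[a *: q]addr0 ipP ?ip0l ?addr0 //.
by rewrite /deg_le size_poly0.
Qed.

Lemma ipDl q q' s : deg_le n q -> deg_le n q' -> deg_le n s ->
  ip (q + q') s = ip q s + ip q' s.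
Proof. by move=> dq dq' ds; rewrite -{1}[q]scale1r ipP // mul1r. Qed.

Lemma ip_ge0 q : deg_le n q -> 0 <= ip q q.
Proof.
move=> dq; have [->|q0] := eqVneq q 0; first by rewrite ip0l // /deg_le size_poly0.
by case: hip => _ _ h; apply/ltW/h.
Qed.

Lemma ipnorm_sqr q : deg_le n q -> ipnorm ip q ^+ 2 = ip q q.
Proof. by move=> dq; rewrite sqr_sqrtr // ip_ge0. Qed.

Lemma deg_leD (q s : {poly R}) : deg_le n q -> deg_le n s -> deg_le n (q + s).
Proof. exact: size_polyD_leq. Qed.

Lemma deg_leZ a (q : {poly R}) : deg_le n q -> deg_le n (a *: q).
Proof. exact: size_polyZ_leq. Qed.

(** For [A = \sum_i u i * v i] and [B = \sum_i v i ^+ 2] this is the objective along the line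
    [u + e v]; in the form [Poly] its derivatives at [0] can be read off the coefficients. *)
Lemma ip_quartic q A B e : deg_le n q -> deg_le n A -> deg_le n B ->
  ip (q + (2 * e) *: A + e ^+ 2 *: B) (q + (2 * e) *: A + e ^+ 2 *: B) =
  (Poly [:: ip q q; 4 * ip A q; 4 * ip A A + 2 * ip B q; 4 * ip A B; ip B B]).[e].
Proof.
move=> dq dA dB; set s := q + _ + _.
have ds : deg_le n s by rewrite /s; do 2?[apply: deg_leD]; rewrite //; apply: deg_leZ.
have ips x : deg_le n x -> ip s x = ip q x + 2 * e * ip A x + e ^+ 2 * ip B x.
  move=> dx; rewrite /s ipDl ?ipDl ?ipZl //; do ?[apply: deg_leD]; rewrite //; exact: deg_leZ.
rewrite ips // !(ipC _ s) // !ips // horner_Poly /=.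
by rewrite (ipC q A) // (ipC q B) // (ipC B A) //; ring.
Qed.

End InnerProduct.

Lemma derive1_Poly_at0 (R : realType) (s : seq R) : derive1 (horner (Poly s)) 0 = s`_1.
Proof. by rewrite -derive.derivE horner_coef0 coef_deriv coef_Poly. Qed.

Lemma derive2_Poly_at0 (R : realType) (s : seq R) :
  derive1n 2 (horner (Poly s)) 0 = s`_2 *+ 2.
Proof. by rewrite /= -!derive.derivE horner_coef0 !coef_deriv coef_Poly. Qed.

Theorem theorem1p1 (R : realType) (d r : nat) (hr : (2 <= r)%N)
  (ip : {poly R} -> {poly R} -> R) (hip : is_inner_product (2 * d) ip)
  (p : {poly R}) (hp : deg_le (2 * d) p) (hpos : forall x : R, 0 <= p.[x])
  (u : 'I_r -> {poly R}) (hu : forall i, deg_le d (u i)) :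
  (* gradient zero: every directional derivative vanishes *)
  (forall v : 'I_r -> {poly R}, (forall i, deg_le d (v i)) ->
     derive1 (fun e : R => f_p ip p (fun i => u i + e *: v i)) 0 = 0) ->
  (* Hessian PSD: every second directional derivative is nonnegative *)
  (forall v : 'I_r -> {poly R}, (forall i, deg_le d (v i)) ->
     0 <= derive1n 2 (fun e : R => f_p ip p (fun i => u i + e *: v i)) 0) ->
  f_p ip p u = 0.
Proof.
(* [ip] is constrained only up to degree [2 d]; precomposing with the truncation [T] gives a
   functional linear on all polynomials. *)
move=> hgrad hhess; pose n := (2 * d)%N; pose T := take_poly n.+1 : {poly R} -> {poly R}.
have dT s : deg_le n (T s) by apply: size_take_poly.
have TK s : deg_le n s -> T s = s by apply: take_poly_id.
have dM (s t : {poly R}) : deg_le d s -> deg_le d t -> deg_le n (s * t).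
  by move=> ds dt; apply: (@size_polyM_leq _ _ _ d d) => //; rewrite /n; lia.
have dS (s : {poly R}) : deg_le d s -> deg_le n (s ^+ 2).
  by move=> ds; rewrite expr2; apply: dM.
have dsum (F : 'I_r -> {poly R}) : (forall i, deg_le n (F i)) -> deg_le n (\sum_i F i).
  by move=> dF; apply: size_poly_sum_leq => i _; apply: dF.
pose q := \sum_(i < r) u i ^+ 2 - p.
have dq : deg_le n q.
  by apply: size_polyD_leq; [apply: dsum => i; apply: dS | rewrite size_polyN].
pose L0 (s : {poly R}) := ip (T s) q.
have L0_lin : scalar L0.
  by move=> a s t; rewrite /L0 /T take_polyD take_polyZ (ipP _ _ _ hip).
pose L : {scalar {poly R}} := HB.pack L0 (GRing.isLinear.Build R {poly R} R _ L0 L0_lin).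
have LE s : deg_le n s -> L s = ip s q by move=> ds; rewrite /L /= /L0 TK.
clearbody L.
(* The second derivative is [2 (4 <A, A> + 2 <B, q>)], that is, [4 (Q A + L B)]. *)
pose Q (y : {poly R}) := 2 * ip (T y) (T y).
have QZ e y : Q (e *: y) = e ^+ 2 * Q y.
  rewrite /Q /T take_polyZ (ipZl _ _ _ hip) ?(ipC _ _ _ hip (T y)) ?(ipZl _ _ _ hip) //.
  - by rewrite /T; ring.
  - exact: (deg_leZ _ _ _ _ (dT y)).
  - exact: (deg_leZ _ _ _ _ (dT y)).
have expand (v : 'I_r -> {poly R}) : (forall i, deg_le d (v i)) ->
    let A := \sum_i u i * v i in let B := \sum_i v i ^+ 2 in
    (fun e : R => f_p ip p (fun i => u i + e *: v i)) =
    horner (Poly [:: ip q q; 4 * ip A q; 4 * ip A A + 2 * ip B q; 4 * ip A B; ip B B]).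
  move=> dv A B; apply/funext => e.
  have dA : deg_le n A by apply: dsum => i; apply: dM.
  have dB : deg_le n B by apply: dsum => i; apply: dS.
  rewrite -(ip_quartic _ _ _ hip) // /f_p.
  have E : \sum_(i < r) (u i + e *: v i) ^+ 2 =
      \sum_(i < r) u i ^+ 2 + (2 * e) *: A + e ^+ 2 *: B.
    rewrite !scaler_sumr -!big_split /=; apply: eq_bigr => i _.
    rewrite -!mul_polyC polyC_exp (_ : 2 * e = e + e) ?polyCD; ring.
  have -> : \sum_(i < r) (u i + e *: v i) ^+ 2 - p = q + (2 * e) *: A + e ^+ 2 *: B.
    by rewrite E /q; ring.
  by rewrite (ipnorm_sqr _ _ _ hip) //; do 2?[apply: deg_leD]; rewrite //; apply: deg_leZ.
have Lgrad (v : 'I_r -> {poly R}) : (forall i, deg_le d (v i)) ->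
    L (\sum_i u i * v i) = 0.
  move=> dv; have := hgrad v dv; rewrite expand // derive1_Poly_at0 /=.
  rewrite LE => [/eqP|]; last by apply: dsum => i; apply: dM.
  by rewrite mulf_eq0 pnatr_eq0 /= => /eqP.
have Lhess (v : 'I_r -> {poly R}) : (forall i, deg_le d (v i)) ->
    0 <= Q (\sum_i u i * v i) + L (\sum_i v i ^+ 2).
  move=> dv; have := hhess v dv; rewrite expand // derive2_Poly_at0 [_`_2]/=.
  rewrite LE; last by apply: dsum => i; apply: dS.
  rewrite /Q TK; last by apply: dsum => i; apply: dM.
  by rewrite mulr2n; lra.
have Lsqr := second_order_sqr_psd _ _ _ L Q u hr QZ hu Lgrad Lhess.
have [t st pE] := poly_nonneg_sos _ _ _ hp hpos.
have Lp : 0 <= L p.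
  rewrite pE linear_sum big_seq; apply: sumr_ge0 => s /(allP st) ss.
  exact: Lsqr.
rewrite /f_p (ipnorm_sqr _ _ _ hip) // -/q.
(* The objective is [<q, q> = L q], and [L] kills [\sum_i u i * u i] by the gradient condition with
   [v = u]; what remains is [- L p <= 0]. *)
apply/eqP; rewrite eq_le (ip_ge0 _ _ _ hip) // andbT -LE // /q linearB /=.
have -> : \sum_(i < r) u i ^+ 2 = \sum_i u i * u i by apply: eq_bigr => i _; rewrite expr2.
by rewrite Lgrad // sub0r oppr_le0.
Qed.
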